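(* Let $U:\mathbb R^d\to\mathbb R$, $\lambda,\gamma>0$, and let $\mu(\mathrm dx)\propto e^{-U(x)}\mathrm dx$ be a probability measure on $\mathbb R^d$ satisfying a Poincaré inequality, with $$\mathrm P_x:=\inf\Bigl\{\frac{\int|\nabla_xf|^2\,\mathrm d\mu}{\int f^2\,\mathrm d\mu}:\ f\in H^1(\mu)\setminus\{0\},\ \int f\,\mathrm d\mu=0\Bigr\}>0.$$ Let $(\hat P_t)_{t\ge0}$ be the transition semigroup on $L^2(\hat\mu)$ of the generalised Langevin dynamics on $\mathbb R^d\times\mathbb R^d\times\mathbb R^d$, $$\mathrm dX_t=V_t\,\mathrm dt,\quad \mathrm dV_t=-\nabla U(X_t)\,\mathrm dt+\lambda Z_t\,\mathrm dt,\quad \mathrm dZ_t=-\lambda V_t\,\mathrm dt-\gamma Z_t\,\mathrm dt+\sqrt{2\gamma}\,\mathrm dW_t,$$ where $\hat\mu=\mu\otimes\mathcal N(0,I_d)\otimes\mathcal N(0,I_d)$ is its invariant probability measure. Then its relaxation time satisfies $$t_{\mathrm{rel}}(\hat P)\ge\tfrac12\,\mathrm P_x^{-1/2}.$$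
   Context: $(W_t)_{t\ge0}$ is a standard $d$-dimensional Brownian motion; $U$ is assumed regular enough that the dynamics is well posed with invariant measure $\hat\mu$. The generator of $(\hat P_t)$ on $L^2(\hat\mu)$ is $$\mathcal L=v\cdot\nabla_x-\nabla U\cdot\nabla_v+\lambda(z\cdot\nabla_v-v\cdot\nabla_z)+\gamma(\Delta_z-z\cdot\nabla_z).$$ The relaxation time is $$t_{\mathrm{rel}}(\hat P)=\inf\{t\ge0:\ \|\hat P_tf\|_{L^2(\hat\mu)}\le e^{-1}\|f\|_{L^2(\hat\mu)}\text{ for all }f\in L^2_0(\hat\mu)\},$$ where $L^2_0(\hat\mu)$ is the space of $f\in L^2(\hat\mu)$ with $\int f\,\mathrm d\hat\mu=0$. *)

(* Defs.v *)
From HB Require Import structures.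
From mathcomp Require Import all_boot all_order all_algebra.
From mathcomp Require Import all_classical all_reals all_analysis.

Set Implicit Arguments.
Unset Strict Implicit.
Unset Printing Implicit Defensive.

Import Order.TTheory GRing.Theory Num.Theory.
Import numFieldNormedType.Exports.

Local Open Scope classical_set_scope.
Local Open Scope ring_scope.

(* The sigma-algebra on R^n generated by the coordinates, i.e. the Borel
   sigma-algebra; same construction as the library's for n.-tuple T. *)
Section measurable_rV.
Context (R : realType) (n : nat).

Let coors : 'I_n -> 'rV[R]_n -> R := fun i x => x ord0 i.

Let rV_set0 : g_sigma_preimage coors set0.
Proof. exact: sigma_algebra0. Qed.

Let rV_setC A : g_sigma_preimage coors A -> g_sigma_preimage coors (~` A).
Proof. exact: sigma_algebraC. Qed.

Let rV_bigcup (F : (set 'rV[R]_n)^nat) : (forall i, g_sigma_preimage coors (F i)) ->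
  g_sigma_preimage coors (\bigcup_i (F i)).
Proof. exact: sigma_algebra_bigcup. Qed.

HB.instance Definition _ := @isMeasurable.Build default_measure_display
  'rV[R]_n (g_sigma_preimage coors) rV_set0 rV_setC rV_bigcup.

End measurable_rV.

Lemma measurable_rV_coord (R : realType) n (i : 'I_n) :
  measurable_fun [set: 'rV[R]_n] (fun x : 'rV[R]_n => x ord0 i).
Proof.
move=> _ Y mY; rewrite setTI; apply: sub_sigma_algebra => /=.
rewrite -bigcup_seq/=; exists i => /=; first by rewrite mem_index_enum.
by exists Y => //; rewrite setTI.
Qed.

Lemma measurable_fun_rVP (R : realType) d (T : measurableType d) n
    (f : T -> 'rV[R]_n) :
  (forall i, measurable_fun [set: T] (fun t => f t ord0 i)) ->
  measurable_fun [set: T] f.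
Proof.
move=> mf.
suff H : g_sigma_preimage (fun i (t : T) => f t ord0 i) `<=` measurable.
  move=> _ A mA; rewrite setTI; apply: H.
  rewrite (g_sigma_preimage_comp (fun i (x : 'rV[R]_n) => x ord0 i) f).
  by exists A => //; rewrite setTI.
apply: smallest_sub; first exact: sigma_algebra_measurable.
case: n => [|n] in f mf *; first by rewrite big_ord0.
rewrite -bigcup_mkord_ord; apply: bigcup_sub => i Ii.
by move=> A [B mB <-]; exact: mf.
Qed.

Section power_measures.
Context (R : realType).

Definition rV_rcons n (p : 'rV[R]_n * measurableTypeR R) : 'rV[R]_n.+1 :=
  \row_i (if unlift ord_max i is Some j then p.1 ord0 j else p.2).

Lemma measurable_rV_rcons n :
  measurable_fun [set: 'rV[R]_n * measurableTypeR R] (@rV_rcons n).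
Proof.
apply: measurable_fun_rVP => i; rewrite /rV_rcons.
case E : (unlift ord_max i) => [j|]; last first.
  by rewrite (_ : (fun _ => _) = snd) //; apply/funext => p; rewrite mxE E.
rewrite (_ : (fun _ => _) = (fun x : 'rV[R]_n => x ord0 j) \o fst); last first.
  by apply/funext => p; rewrite mxE E.
by apply: measurableT_comp => //; exact: measurable_rV_coord.
Qed.

HB.instance Definition _ n :=
  isMeasurableFun.Build _ _ _ _ (@rV_rcons n) (@measurable_rV_rcons n).

Section lebesgue_rV_succ.
Variables (n : nat) (m : {measure set 'rV[R]_n -> \bar R}).

Definition lebesgue_rV_succ : set 'rV[R]_n.+1 -> \bar R :=
  pushforward (m \x lebesgue_measure)%E (@rV_rcons n).

Let succ0 : lebesgue_rV_succ set0 = 0%E.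
Proof. by rewrite /lebesgue_rV_succ /pushforward preimage_set0 measure0. Qed.

Let succ_ge0 A : (0 <= lebesgue_rV_succ A)%E.
Proof. by rewrite /lebesgue_rV_succ /pushforward; exact: measure_ge0. Qed.

Let succ_sigma_additive : semi_sigma_additive lebesgue_rV_succ.
Proof.
exact: (@measure_semi_sigma_additive _ _ _
  (measure_function_pushforward__canonical__measure_function_Measure
     (m \x lebesgue_measure)%E (@measurable_rV_rcons n))).
Qed.

HB.instance Definition _ :=
  isMeasure.Build _ _ _ lebesgue_rV_succ succ0 succ_ge0 succ_sigma_additive.

End lebesgue_rV_succ.

Fixpoint lebesgue_rV n : {measure set 'rV[R]_n -> \bar R} :=
  match n with
  | 0 => \d_(0 : 'rV[R]_0)
  | n'.+1 => lebesgue_rV_succ (lebesgue_rV n')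
  end.

Fixpoint prob_rV (P : probability (measurableTypeR R) R) n :
    probability 'rV[R]_n R :=
  match n with
  | 0 => \d_(0 : 'rV[R]_0)
  | n'.+1 => distribution (prob_rV P n' \x P)%E (@rV_rcons n')
  end.

End power_measures.

Section calculus.
Context (R : realType) (d : nat).
Implicit Types f : 'rV[R]_d -> R.

Definition partial (i : 'I_d) f (x : 'rV[R]_d) : R := 'D_(delta_mx ord0 i) f x.

Definition grad f (x : 'rV[R]_d) : 'rV[R]_d := \row_i partial i f x.

(* Squared Euclidean norm; the library's norm on 'rV is the sup norm. *)
Definition sqnorm (x : 'rV[R]_d) : R := \sum_i x ord0 i ^+ 2.

Fixpoint Ck k f : Prop :=
  match k with
  | 0 => continuous f
  | k'.+1 => (forall x, differentiable f x) /\ forall i, Ck k' (partial i f)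
  end.

Definition smooth f := forall k, Ck k f.

End calculus.

Section sobolev.
Context (R : realType) (d : nat).
Variable mu : probability 'rV[R]_d R.

Definition proportional_to_exp_opp (U : 'rV[R]_d -> R) :=
  exists2 c : R, 0 < c & forall A : set 'rV[R]_d, measurable A ->
    mu A = (\int[lebesgue_rV R d]_(x in A) (c * expR (- U x))%:E)%E.

(* H^1(mu) is the closure, for the norm f |-> |f|_L2 + |grad f|_L2, of the
   smooth functions for which this norm is finite;
   [H1 f g] means that f is in H^1(mu) with gradient g. *)
Definition H1 (f : 'rV[R]_d -> R) (g : 'rV[R]_d -> 'rV[R]_d) : Prop :=
  [/\ f \in Lfun mu 2%:E,
      forall i, (fun x => g x ord0 i) \in Lfun mu 2%:E
    & exists phi : nat -> 'rV[R]_d -> R,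
      [/\ forall n, smooth (phi n),
          forall n, phi n \in Lfun mu 2%:E,
          forall n i, partial i (phi n) \in Lfun mu 2%:E,
          ('N[mu]_2%:E [EFin \o (phi n \- f)%R])%E @[n --> \oo] --> 0%E
        & forall i, ('N[mu]_2%:E [EFin \o
            (fun x => partial i (phi n) x - g x ord0 i)%R])%E @[n --> \oo] --> 0%E]].

Definition rayleigh_quotients : set R :=
  [set r | exists f g, [/\ H1 f g, ~ {ae mu, forall x, f x = 0},
     \int[mu]_x f x = 0
   & r = (\int[mu]_x sqnorm (g x)) / (\int[mu]_x (f x ^+ 2))]].

(* The infimum of reals is 0 on the empty set, which occurs only for d = 0. *)
Definition poincare_constant : R := inf rayleigh_quotients.

End sobolev.

Section relaxation_time.
Context (R : realType) (d : measure_display) (T : measurableType d).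

Definition L20 (mu : probability T R) : set (T -> R) :=
  [set f | f \in Lfun mu 2%:E /\ \int[mu]_x f x = 0].

Definition semigroup_op (P : R -> R.-pker T ~> T) (t : R) (f : T -> R) : T -> R :=
  fun y => \int[P t y]_y' f y'.

Definition markov_semigroup (P : R -> R.-pker T ~> T) : Prop :=
  (forall y A, measurable A -> P 0 y A = \d_y A) /\
  (forall (s t : R) y A, 0 <= s -> 0 <= t -> measurable A ->
     P (s + t) y A = (\int[P s y]_y' P t y' A)%E).

Definition invariant_measure (mu : probability T R) (P : R -> R.-pker T ~> T) : Prop :=
  forall (t : R) A, 0 <= t -> measurable A -> (\int[mu]_y P t y A = mu A)%E.

(* Extended real, so that the infimum of the empty set is +oo. *)
Definition relaxation_time (mu : probability T R) (P : R -> R.-pker T ~> T) :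
    \bar R :=
  ereal_inf [set t%:E | t in [set t : R | 0 <= t /\
    forall f, L20 mu f ->
      ('N[mu]_2%:E [EFin \o semigroup_op P t f]
         <= (expR (-1))%:E * 'N[mu]_2%:E [EFin \o f])%E]].

End relaxation_time.

Notation phase_space R d := ('rV[R]_d * 'rV[R]_d * 'rV[R]_d)%type.

Section generalised_langevin.
Context (R : realType) (d : nat).

(* Covariance s times the identity, s > 0; the library's normal_prob takes the
   standard deviation. *)
Definition gaussian_rV (s : R) : probability 'rV[R]_d R :=
  prob_rV (normal_prob 0 (Num.sqrt s)) d.

Definition mu_hat (mu : probability 'rV[R]_d R) :
    probability (phase_space R d) R :=
  ((mu \x gaussian_rV 1) \x gaussian_rV 1)%E.

Section sde.
Context (dO : measure_display) (Omega : measurableType dO).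
Variables (Pr : probability Omega R) (F : R -> set (set Omega)).

Record filtration : Prop := Filtration {
  filtration_sigma_algebra : forall t, 0 <= t -> sigma_algebra setT (F t);
  filtration_measurable : forall t, 0 <= t -> F t `<=` measurable;
  filtration_le : forall s t, 0 <= s -> s <= t -> F s `<=` F t }.

Definition adapted dE (E : measurableType dE) (Y : R -> Omega -> E) : Prop :=
  forall t A, 0 <= t -> measurable A -> F t (Y t @^-1` A).

Definition continuous_paths (E : topologicalType) (Y : R -> Omega -> E) : Prop :=
  forall w, {within `[0%R, +oo[, continuous (Y ^~ w)}.

(* Standard Brownian motion with respect to F; the last field says at once that
   W t - W s is independent of F s and that its law is N(0, (t - s) I_d). *)
Record brownian_motion (W : R -> Omega -> 'rV[R]_d) : Prop := BrownianMotion {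
  brownian_adapted : adapted W;
  brownian_continuous : continuous_paths W;
  brownian0 : {ae Pr, forall w, W 0 w = 0};
  brownian_increments : forall s t B A, 0 <= s -> s < t ->
    F s B -> measurable A ->
    Pr (B `&` [set w | A (W t w - W s w)]) = (Pr B * gaussian_rV (t - s) A)%E }.

Variables (U : 'rV[R]_d -> R) (lambda gamma : R).

(* The noise being additive, the SDE in integral form involves no stochastic
   integral. *)
Record gle_solution (W X V Z : R -> Omega -> 'rV[R]_d)
    (y0 : phase_space R d) : Prop := GleSolution {
  gle_adapted : [/\ adapted X, adapted V & adapted Z];
  gle_continuous :
    [/\ continuous_paths X, continuous_paths V & continuous_paths Z];
  gle_equations : {ae Pr, forall w, forall t i, 0 <= t -> [/\
    X t w ord0 i = y0.1.1 ord0 i +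
      \int[lebesgue_measure]_(s in `[0, t]) V s w ord0 i,
    V t w ord0 i = y0.1.2 ord0 i +
      \int[lebesgue_measure]_(s in `[0, t])
        (- grad U (X s w) ord0 i + lambda * Z s w ord0 i)
  & Z t w ord0 i = y0.2 ord0 i +
      \int[lebesgue_measure]_(s in `[0, t])
        (- lambda * V s w ord0 i - gamma * Z s w ord0 i) +
      Num.sqrt (2 * gamma) * W t w ord0 i]} }.

End sde.

(* Well-posedness: from every starting point there is a weak solution, and
   P t y0 is the law at time t of every weak solution started at y0. *)
Definition gle_transition_semigroup (U : 'rV[R]_d -> R) (lambda gamma : R)
    (P : R -> R.-pker (phase_space R d) ~> (phase_space R d)) : Prop :=
  [/\ markov_semigroup P,
      forall y0, exists (dO : measure_display) (Omega : measurableType dO)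
        (Pr : probability Omega R) (F : R -> set (set Omega))
        (W X V Z : R -> Omega -> 'rV[R]_d),
        [/\ filtration F, brownian_motion Pr F W
           & gle_solution Pr F U lambda gamma W X V Z y0]
    & forall y0 (dO : measure_display) (Omega : measurableType dO)
        (Pr : probability Omega R) (F : R -> set (set Omega))
        (W X V Z : R -> Omega -> 'rV[R]_d),
        filtration F -> brownian_motion Pr F W ->
        gle_solution Pr F U lambda gamma W X V Z y0 ->
        forall t A, 0 <= t -> measurable A ->
          Pr [set w | A (X t w, V t w, Z t w)] = P t y0 A].

End generalised_langevin.

(* Main.v *)
Require Import Defs.
From mathcomp Require Import all_boot all_order all_algebra.
From mathcomp Require Import all_classical all_reals all_analysis.
From mathcomp Require Import measurable_realfun ring lra.
Set Implicit Arguments.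
Unset Strict Implicit.
Unset Printing Implicit Defensive.
Import Order.TTheory GRing.Theory Num.Theory.
Import numFieldNormedType.Exports.
Local Open Scope classical_set_scope.
Local Open Scope ring_scope.

(* Let Phi (x, v, z) = phi x. Along a path of the dynamics,
   phi X_t - phi X_0 = int_0^t (grad phi X_s . V_s) ds, and under the invariant
   law the velocity is a standard Gaussian independent of the position, so that
   |P_t Phi - Phi|_L2 <= t |grad phi|_L2(mu). If |P_t Phi| <= e^-1 |Phi|, then
   (1 - e^-1) |phi| <= t |grad phi|; taking the infimum over phi gives
   t >= (1 - e^-1) P_x^(-1/2) >= P_x^(-1/2) / 2.
   The time integral is handled pathwise as a limit of Riemann sums: Jensen's
   inequality and Fatou's lemma (on the probability space, then in the starting
   point) reduce the estimate to the invariance of mu_hat at each fixed time, so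
   no joint measurability in time is needed. *)

(** * Measurability and mixtures *)

(** The norm is the sup norm, so a ball is a finite intersection of coordinate slabs. An open set is
    a countable union of cubes with rational centre and radius [k.+1%:R^-1]. *)
Lemma open_measurable_rV (R : realType) n (A : set 'rV[R]_n) :
  open A -> measurable A.
Proof.
move=> oA.
pose q (p : 'rV[rat]_n * nat) : set 'rV[R]_n :=
  [set x | forall i, `|ratr (p.1 ord0 i) - x ord0 i| < p.2.+1%:R^-1].
have mq p : measurable (q p).
  have -> : q p = \bigcap_(i in [set` 'I_n])
      ((fun x : 'rV[R]_n => x ord0 i) @^-1`
        [set y | `|ratr (p.1 ord0 i) - y| < p.2.+1%:R^-1]).
    by apply/seteqP; split => x /= qx i //=; exact: qx.
  rewrite -[X in measurable X]setCK setC_bigcap; apply: measurableC.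
  apply: fin_bigcup_measurable => // i _; apply: measurableC.
  rewrite -[X in measurable X]setTI.
  apply: measurable_rV_coord => //.
  exact: measurable_ball.
(* Cubes that leave [A] are replaced by [set0], which keeps the union indexed by one fixed countable
   type. *)
have -> : A = \bigcup_p (if `[< q p `<=` A >] then q p else set0).
  apply/seteqP; split => [x Ax|x [p _]]; last first.
    by case: asboolP => // qA; exact: qA.
  have /nbhs_ballP[e /= e0 xeA] := open_nbhs_nbhs (conj oA Ax).
  (* A cube of radius below [e / 2] that contains [x] lies in the ball of radius [e] around [x]. *)
  have [k ke] : exists k : nat, k.+1%:R^-1 < e / 2.
    have [k _ kH] := near_infty_natSinv_lt (PosNum (divr_gt0 e0 (ltr0n R 2))).
    by exists k; exact: kH (leqnn k).
  have /choice[c cx] (i : 'I_n) : exists c : rat,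
      `|ratr c - x ord0 i| < k.+1%:R^-1.
    have k0 : (0 : R) < k.+1%:R^-1 by rewrite invr_gt0.
    have /rat_in_itvoo[c] : x ord0 i < x ord0 i + k.+1%:R^-1 by rewrite ltrDl.
    rewrite in_itv/= => /andP[c1 c2]; exists c.
    rewrite ltr_norml; move: k0 c2; move: (k.+1%:R^-1) => u k0 c2.
    by apply/andP; split; lra.
  exists (\row_i c i, k) => //=.
  have xq : q (\row_i c i, k) x by move=> i /=; rewrite mxE.
  case: asboolP => // -[] y qy; apply: xeA; split=> // i j /=.
  rewrite ord1 -ball_normE /=.
  have := xq j; have := qy j.
  move: ke; rewrite /=; move: (k.+1%:R^-1) => u ke; rewrite !ltr_norml => /andP[a1 a2] /andP[b1 b2].
  by apply/andP; split; lra.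
apply: countable_bigcupT_measurable => // p.
by case: ifP.
Qed.

Lemma continuous_measurable_rV (R : realType) n (f : 'rV[R]_n -> R) :
  continuous f -> measurable_fun setT f.
Proof.
move=> /continuousP cf; apply: (measurability _ (RGenOpens.measurableE R)).
move=> _ [_ [a [b ->] <-]]; rewrite setTI; apply: open_measurable_rV.
exact/cf/interval_open.
Qed.

Section ge0_integrals.
Local Open Scope ereal_scope.
Import HBNNSimple.

(** Carries the identity from sets to nonnegative functions. With [k] a transition kernel and
    [nu = mu] this is invariance tested on functions. *)
Lemma ge0_integral_mixture d d' (T : measurableType d) (T' : measurableType d')
    (R : realType) (mu : {measure set T -> \bar R})
    (nu : {measure set T' -> \bar R}) (k : T -> {measure set T' -> \bar R}) :
  (forall A, measurable A -> measurable_fun setT (k ^~ A)) ->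
  (forall A, measurable A -> \int[mu]_x k x A = nu A) ->
  forall f : T' -> \bar R, measurable_fun setT f -> (forall x, 0 <= f x) ->
  \int[mu]_x (\int[k x]_y f y) = \int[nu]_y f y.
Proof.
move=> mk nuE f mf f0.
pose f_ := nnsfun_approx measurableT mf.
have f_cvg (m : {measure set T' -> \bar R}) :
    \int[m]_y f y = limn (fun n => \int[m]_y (f_ n y)%:E).
  rewrite -monotone_convergence//; last 3 first.
  - by move=> n; exact/measurable_EFinP.
  - by move=> n z _; rewrite lee_fin.
  - by move=> z _ a b ab; rewrite lee_fin; exact/lefP/nd_nnsfun_approx.
  apply/eq_integral => z _; apply/esym/cvg_lim => //=; exact: cvg_nnsfun_approx.
under eq_integral do rewrite f_cvg.
rewrite f_cvg monotone_convergence//; last 3 first.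
- move=> n; apply: measurable_fun_integral_kernel => //.
    by move=> z; rewrite lee_fin.
  exact/measurable_EFinP.
- by move=> n y _; apply: integral_ge0 => // z _; rewrite lee_fin.
- move=> y _ a b ab; apply: ge0_le_integral => //.
  + by move=> z _; rewrite lee_fin.
  + exact/measurable_EFinP.
  + exact/measurable_EFinP.
  + by move=> z _; rewrite lee_fin; exact/lefP/nd_nnsfun_approx.
(* For a simple function both sides are finite sums over its values, and the hypothesis on sets
   applies termwise. *)
apply: congr_lim; apply/funext => n.
under eq_integral do rewrite integralT_nnsfun sintegralE.
rewrite integralT_nnsfun sintegralE ge0_integral_fsum//; last 2 first.
- by move=> r; apply: measurable_funeM; exact: mk.
- move=> r y _; have := mulemu_ge0 (fun r => f_ n @^-1` [set r]).
  by apply=> /= r0; rewrite preimage_nnfun0.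
apply: eq_fsbigr => r; rewrite inE => -[x0 _ <-].
by rewrite ge0_integralZl// ?nuE ?lee_fin//; exact: mk.
Qed.

(** A measure with density [p] is the mixture over [mu] of the point masses [p x] at [x]. *)
Lemma ge0_integral_density d (T : measurableType d) (R : realType)
    (mu nu : {measure set T -> \bar R}) (p : T -> R) :
  measurable_fun setT p -> (forall x, 0 <= p x)%R ->
  (forall A, measurable A -> nu A = \int[mu]_(x in A) (p x)%:E) ->
  forall f : T -> \bar R, measurable_fun setT f -> (forall x, 0 <= f x) ->
  \int[nu]_x f x = \int[mu]_x ((p x)%:E * f x).
Proof.
move=> mp p0 nuE f mf f0.
pose k x : {measure set T -> \bar R} := mscale (NngNum (p0 x)) (dirac x).
have kE x A : k x A = (p x)%:E * (\1_A x)%:E by [].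
rewrite -(@ge0_integral_mixture _ _ _ _ _ mu nu k)//.
- apply: eq_integral => x _; rewrite ge0_integral_mscale//.
  by rewrite integral_dirac// diracT mul1e.
- move=> A mA; under eq_fun do rewrite kE.
  by apply: emeasurable_funM; exact/measurable_EFinP.
- move=> A mA; rewrite nuE// [RHS]integral_mkcond; apply: eq_integral => x _.
  by rewrite kE patchE indicE; case: ifP => _; rewrite ?mule1 ?mule0.
Qed.

End ge0_integrals.

(** * Fatou's lemma and Gaussian moments *)

Lemma measurable_fun_limn_einf d (T : measurableType d) (R : realType)
    (f : (T -> \bar R)^nat) :
  (forall n, measurable_fun setT (f n)) ->
  measurable_fun setT (fun x => limn_einf (f^~ x)).
Proof.
move=> mf; apply: measurableT_comp => //.
by apply: measurable_fun_limn_esup => n; exact: measurableT_comp.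
Qed.

(** Almost everywhere the limit [g] equals the lower limit, so the usual Fatou lemma applies. *)
Lemma fatou_ae_le d (T : measurableType d) (R : realType)
    (mu : {measure set T -> \bar R}) (f : (T -> \bar R)^nat) (g : T -> \bar R) :
  (forall n, measurable_fun setT (f n)) -> (forall n x, 0 <= f n x)%E ->
  measurable_fun setT g ->
  {ae mu, forall x, f ^~ x @ \oo --> g x} ->
  (\int[mu]_x g x <= limn_einf (fun n => \int[mu]_x f n x))%E.
Proof.
move=> mf f0 mg fg.
have -> : (\int[mu]_x g x = \int[mu]_x limn_einf (f^~ x))%E.
  apply: ae_eq_integral => //; first exact: measurable_fun_limn_einf.
  by apply: filterS fg => x /cvg_limn_einf_sup[-> _].
exact: fatou.
Qed.

Lemma le_limn_einf (R : realType) (u v : (\bar R)^nat) :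
  (forall n, u n <= v n)%E -> (limn_einf u <= limn_einf v)%E.
Proof.
move=> uv; rewrite !limn_einf_lim; apply: lee_lim; [exact: is_cvg_einfs..|].
apply: nearW => n; apply: le_ereal_inf_tmp => _ [m /= nm <-].
by apply: ge_ereal_inf; exists (u m) => //=; exists m.
Qed.

Section gaussian_moments.
Variable R : realType.
Notation gpdf := (normal_pdf (0 : R) 1).

Let gpdfE x : gpdf x = normal_peak 1 * expR (- (x ^+ 2 / 2)).
Proof.
rewrite normal_pdfE ?oner_neq0// /normal_fun.
by rewrite subr0 expr1n mulNr.
Qed.

(** Written as a combination of functions, so that its derivative can be inferred from its shape;
    [gprimE] gives the readable form. *)
Let gprim (s b : R) : R -> R := normal_peak 1 \*:
  ((cst (- (2 * s * b)) - b ^+ 2 \*: id) * (expR \o (- 2^-1 \*: (id ^+ 2)))).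

Let gprimE (s b x : R) : gprim s b x = - (2 * s * b + b ^+ 2 * x) * gpdf x.
Proof.
rewrite gpdfE /gprim /= !fctE /= /GRing.scale /=.
have -> : - 2^-1 * x ^+ 2 = - (x ^+ 2 / 2) by field.
by ring.
Qed.

Let is_derive_gprim (s b x : R) :
  is_derive x (1 : R) (gprim s b) ((s + b * x) ^+ 2 * gpdf x - (s ^+ 2 + b ^+ 2) * gpdf x).
Proof.
rewrite gpdfE; apply: is_derive_eq; rewrite /= /GRing.scale /= !fctE /=.
have -> : - 2^-1 * x ^+ 2 = - (x ^+ 2 / 2) by field.
rewrite /cst /= [b ^+ 2 *: x](_ : _ = b ^+ 2 * x)//; by field.
Qed.

(* On [-n, n] the integrand minus [s^2 + b^2] times the density has the
   primitive [-(2 s b + b^2 w) pdf w], whose increment is [-2 b^2 n pdf n <= 0]. *)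
Lemma normal_second_moment_le (s b : R) :
  (\int[normal_prob 0 1]_w ((s + b * w) ^+ 2)%:E <= (s ^+ 2 + b ^+ 2)%:E)%E.
Proof.
pose c := s ^+ 2 + b ^+ 2.
pose h x := (s + b * x) ^+ 2 * gpdf x.
have cgpdf : continuous gpdf by apply: continuous_normal_pdf; rewrite oner_neq0.
have cq : continuous (fun x => (s + b * x) ^+ 2).
  have cl : continuous (fun x => s + b * x).
    by move=> x; apply: cvgD; [exact: cvg_cst|apply: cvgM; [exact: cvg_cst|exact: cvg_id]].
  by move=> x; under eq_fun do rewrite expr2; apply: cvgM; exact: cl.
have mq := continuous_measurable_fun cq.
have ch : continuous h by move=> x; apply: cvgM; [exact: cq|exact: cgpdf].
have h0 x : 0 <= h x by rewrite mulr_ge0 ?sqr_ge0// normal_pdf_ge0.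
have mh : measurable_fun setT h by exact: continuous_measurable_fun.
rewrite (@ge0_integral_density _ _ _ lebesgue_measure _ gpdf)//; last 4 first.
- exact: measurable_normal_pdf.
- by move=> x; exact: normal_pdf_ge0.
- exact/measurable_EFinP.
- by move=> x; rewrite lee_fin sqr_ge0.
under eq_integral do rewrite -EFinM mulrC -/(h _).
(* The successor keeps the endpoints strictly ordered, also for [n = 0]. *)
pose D n : set R := `[- n.+1%:R, n.+1%:R]%classic.
have mD n : measurable (D n) by exact: measurable_itv.
have hD n : (\int[lebesgue_measure]_(x in D n) (h x)%:E <= c%:E)%E.
  have n0 : - n.+1%:R < n.+1%:R :> R by rewrite gtrN.
  have itg (f : R -> R) : continuous f ->
      lebesgue_measure.-integrable (D n) (EFin \o f).
    move=> cf; apply: continuous_compact_integrable; first exact: segment_compact.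
    exact: continuous_subspaceT.
  have FTC : (\int[lebesgue_measure]_(x in D n) (h x - c * gpdf x)%:E =
      (gprim s b n.+1%:R)%:E - (gprim s b (- n.+1%:R))%:E)%E.
    have dF (x : R) : derivable (gprim s b) x 1 by case: (is_derive_gprim s b x).
    apply: continuous_FTC2 => //.
    + apply: continuous_subspaceT => x.
      apply: cvgB; first exact: ch.
      by apply: cvgM; [exact: cvg_cst|exact: cgpdf].
    + have cF : continuous (gprim s b).
        by move=> x; exact/differentiable_continuous/derivable1_diffP.
      split => //; apply: cvg_within_filter; exact: cF.
    + by move=> x _; rewrite derive1E; apply: derive_val.
  have cgc : continuous (fun x => c * gpdf x).
    by move=> x; apply: cvgM; [exact: cvg_cst|exact: cgpdf].
  move: FTC; under eq_integral do rewrite EFinB.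
  have mDn := mD n.
  rewrite integralB//; [|exact: (itg h)|exact: (itg _ cgc)].
  have -> : (\int[lebesgue_measure]_(x in D n) (c * gpdf x)%:E =
      c%:E * normal_prob 0 1 (D n))%E.
    rewrite /normal_prob -ge0_integralZl ?lee_fin ?addr_ge0 ?sqr_ge0//.
    - by apply: measurable_funTS; apply/measurable_EFinP; exact: measurable_normal_pdf.
    - by move=> x _; rewrite lee_fin normal_pdf_ge0.
  have P1 : (normal_prob 0 1 (D n) <= 1 :> \bar R)%E by exact: probability_le1.
  have Pf : (normal_prob 0 1 (D n) \is a @fin_num R).
    by exact: fin_num_measure.
  move: P1; rewrite -(fineK Pf) lee_fin => P1.
  have If : (\int[lebesgue_measure]_(x in D n) (h x)%:E)%E \is a fin_num.
    by apply: integrable_fin_num => //; exact: (itg h).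
  rewrite -(fineK If) -EFinM -!EFinB lee_fin => -[] /eqP.
  rewrite subr_eq => /eqP ->.
  rewrite !gprimE (_ : gpdf (- n.+1%:R) = gpdf n.+1%:R); last first.
    by rewrite !gpdfE sqrrN.
  have c0 : 0 <= c by rewrite addr_ge0 ?sqr_ge0.
  (* What remains: [D n] has mass at most one, and the increment of the primitive is nonpositive. *)
  have := ler_wpM2l c0 P1.
  have := mulr_ge0 (mulr_ge0 (sqr_ge0 b) (ler0n R n.+1)) (normal_pdf_ge0 0 1 n.+1%:R).
  set m : R := n.+1%:R; set g := normal_pdf 0 1 m; set b2 := b ^+ 2.
  rewrite (_ : 1 *- n.+1 = - m)//; move: (fine _) => p.
  (* The terms in [2 * s * b] at the two endpoints cancel because the density is even. *)
  by lra.
apply: (@le_trans _ _ (limn_einf (fun n =>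
    (* At each point the integrand cut off outside [D n] is eventually equal to [h], so Fatou
       carries the uniform bound to the whole line. *)
    \int[lebesgue_measure]_x (((EFin \o h) \_ (D n)) x))))%E.
  apply: fatou_ae_le.
  - move=> n; have mDn := mD n; apply/(measurable_restrictT (EFin \o h) mDn).
    by apply: measurable_funTS; exact/measurable_EFinP.
  - by move=> n x; rewrite patchE; case: ifP; rewrite ?lee_fin.
  - exact/measurable_EFinP.
  apply: aeW => x; apply: cvg_near_cst.
  have [k xk] : exists k : nat, `|x| <= k%:R.
    by exists (Num.trunc `|x|).+1; exact/ltW/truncnS_gt.
  exists k => // n /= kn; rewrite patchE mem_set//= /D /= in_itv/=.
  rewrite -ler_norml (le_trans xk)// ler_nat; exact: leq_trans kn _.
rewrite limn_einf_lim; apply: lime_le; first exact: is_cvg_einfs.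
apply: nearW => n; apply: ge_ereal_inf.
exists (\int[lebesgue_measure]_x (((EFin \o h) \_ (D n)) x))%E.
  by exists n => /=.
by rewrite -integral_mkcond.
Qed.
End gaussian_moments.

Lemma measurable_lincomb (R : realType) d (T : measurableType d) n
    (a v : 'I_n -> T -> R) :
  (forall i, measurable_fun setT (a i)) -> (forall i, measurable_fun setT (v i)) ->
  measurable_fun setT (fun x => \sum_i a i x * v i x).
Proof.
by move=> ma mv; apply: measurable_sum => i; exact: measurable_funM.
Qed.

Lemma sum_lift_max (R : nmodType) n (F : 'I_n.+1 -> R) :
  \sum_i F i = \sum_j F (lift ord_max j) + F ord_max.
Proof.
rewrite big_ord_recr; congr (_ + _); apply: eq_bigr => i _; congr F.
by apply: val_inj; rewrite /= /bump leqNgt ltn_ord.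
Qed.

Lemma normal_rV_second_moment_le (R : realType) n (a : 'I_n -> R) :
  (\int[prob_rV (normal_prob 0 1) n]_v ((\sum_i a i * v ord0 i) ^+ 2)%:E
     <= (\sum_i a i ^+ 2)%:E)%E.
Proof.
have mq m (c : 'I_m -> R) :
    measurable_fun setT (fun v : 'rV[R]_m => ((\sum_i c i * v ord0 i) ^+ 2)%:E).
  apply/measurable_EFinP/measurable_funX/measurable_lincomb => // i.
  exact: measurable_rV_coord.
have q0 (x : R) : (0 <= (x ^+ 2)%:E)%E by rewrite lee_fin sqr_ge0.
elim: n a => [|n IHn] a.
  under eq_integral do rewrite big_ord0 expr0n/=.
  by rewrite big_ord0 integral0.
rewrite /= ge0_integral_distribution//=; last exact: mq.
have mqr : measurable_fun setT (fun p : 'rV[R]_n * measurableTypeR R =>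
    ((\sum_i a i * rV_rcons p ord0 i) ^+ 2)%:E).
  exact: measurableT_comp (mq _ a) (@measurable_rV_rcons _ _).
rewrite fubini_tonelli1//=.
pose s (u : 'rV[R]_n) := \sum_j a (lift ord_max j) * u ord0 j.
pose b := a ord_max.
apply: (@le_trans _ _ (\int[prob_rV (normal_prob 0 1) n]_u
    ((s u ^+ 2)%:E + (b ^+ 2)%:E)))%E.
  apply: ge0_le_integral => //=.
  - by move=> u _; exact: integral_ge0.
  - exact: measurable_fun_fubini_tonelli_F.
  - apply: emeasurable_funD => //; exact: mq.
  - move=> u _; rewrite -EFinD /fubini_F.
    apply: le_trans (normal_second_moment_le (s u) b).
    rewrite le_eqVlt; apply/orP; left; apply/eqP; apply: eq_integral => w _.
    rewrite sum_lift_max mxE unlift_none /=; congr (((_ + _) ^+ 2)%:E).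
    by apply: eq_bigr => j _; rewrite mxE liftK.
rewrite ge0_integralD//=; last exact: mq.
rewrite integral_cst//= probability_setT mule1 (sum_lift_max (fun i => a i ^+ 2)).
rewrite EFinD. apply: leeD2r; exact: (IHn (fun j => a (lift ord_max j))).
Qed.

(** * Marginals of the invariant measure *)

Lemma ge0_integral_prod_fst d1 d2 (T1 : measurableType d1)
    (T2 : measurableType d2) (R : realType) (m1 : probability T1 R)
    (m2 : probability T2 R) (f : T1 -> \bar R) :
  measurable_fun setT f -> (forall x, 0 <= f x)%E ->
  (\int[(m1 \x m2)%E]_z f z.1 = \int[m1]_x f x)%E.
Proof.
move=> mf f0; rewrite fubini_tonelli1//=; last exact: measurableT_comp.
apply: eq_integral => x _; rewrite /fubini_F /=.
by rewrite integral_cst//= probability_setT mule1.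
Qed.

Section mu_hat_marginals.
Context (R : realType) (d : nat) (mu : probability 'rV[R]_d R).
Implicit Type f : 'rV[R]_d -> R.

Lemma ge0_integral_mu_hat_position (f : 'rV[R]_d -> \bar R) :
  measurable_fun setT f -> (forall x, 0 <= f x)%E ->
  (\int[mu_hat mu]_y f y.1.1 = \int[mu]_x f x)%E.
Proof.
move=> mf f0.
rewrite (ge0_integral_prod_fst _ _ (f := fun p => f p.1))//.
  by rewrite ge0_integral_prod_fst.
exact: measurableT_comp.
Qed.

Lemma Rintegral_mu_hat_position f : measurable_fun setT f ->
  \int[mu_hat mu]_y f y.1.1 = \int[mu]_x f x.
Proof.
move=> mf; have mEf : measurable_fun setT (EFin \o f) by exact/measurable_EFinP.
rewrite /Rintegral; congr fine; rewrite integralE [RHS]integralE.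
rewrite -(ge0_integral_mu_hat_position (f := (EFin \o f)^\+)%E)//; last first.
  exact: measurable_funepos.
rewrite -(ge0_integral_mu_hat_position (f := (EFin \o f)^\-)%E)//; last first.
  exact: measurable_funeneg.
congr (_ - _)%E; apply: eq_integral => y _.
  by rewrite !funeposE.
by rewrite !funenegE.
Qed.

(* Under [mu_hat] the velocity is independent of the position and standard Gaussian. *)
Lemma mu_hat_velocity_second_moment_le (g : 'I_d -> 'rV[R]_d -> R) :
  (forall i, measurable_fun setT (g i)) ->
  (\int[mu_hat mu]_y ((\sum_i g i y.1.1 * y.1.2 ord0 i) ^+ 2)%:E
     <= \int[mu]_x (\sum_i g i x ^+ 2)%:E)%E.
Proof.
move=> mg.
pose G (p : 'rV[R]_d * 'rV[R]_d) := ((\sum_i g i p.1 * p.2 ord0 i) ^+ 2)%:E.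
have mG : measurable_fun setT G.
  apply/measurable_EFinP/measurable_funX/measurable_lincomb => i.
    exact: measurableT_comp (mg i) measurable_fst.
  exact: measurableT_comp (measurable_rV_coord i) measurable_snd.
have G0 p : (0 <= G p)%E by rewrite lee_fin sqr_ge0.
(* The integrand does not depend on the third component; for fixed [x], Fubini leaves a Gaussian
   second moment with coefficients [g i x]. *)
rewrite (ge0_integral_prod_fst _ _ mG)//= fubini_tonelli1//=.
apply: ge0_le_integral => //=.
- by move=> x _; apply: integral_ge0 => v _; exact: G0.
- exact: measurable_fun_fubini_tonelli_F.
- by apply/measurable_EFinP/measurable_sum => i; exact: measurable_funX.
- move=> x _; rewrite /fubini_F /gaussian_rV sqrtr1.
  exact: (normal_rV_second_moment_le (fun i => g i x)).
Qed.

End mu_hat_marginals.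

(** * Riemann sums along paths *)

(** Only [x] is confined to the segment. Compactness turns the pointwise moduli, taken at half
    scale, into a common [r]. *)
Lemma uniform_continuity_segment (R : realType) (g : R -> R) (a b e : R) :
  continuous g -> 0 < e ->
  exists2 r, 0 < r & forall x y, x \in `[a, b] -> `|x - y| < r -> `|g x - g y| < e.
Proof.
move=> cg e0.
pose Q (r x : R) := forall y, `|x - y| < r -> `|g x - g y| < e.
have : \forall r \near (0 : R)^'+, `[a, b] `<=` Q r.
  apply: (compact_near_coveringP _).1; first exact: segment_compact.
  move=> x _.
  have e2 : 0 < e / 2 by rewrite divr_gt0.
  have /cvgrPdist_lt/(_ _ e2) := cg x.
  move=> /nbhs_ballP[d /= d0 xd].
  exists (ball x (d / 2), [set r | r < d / 2]).
    split => /=; first by apply: nbhsx_ballx; rewrite divr_gt0.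
    by apply: nbhs_right_lt; rewrite divr_gt0.
  move=> [x' r] [/= xx' rd] y x'y.
  have gy : `|g x - g y| < e / 2.
    apply: xd; rewrite -ball_normE /= in xx' *.
    rewrite -(subrKA x') (le_lt_trans (ler_normD _ _))//.
    by rewrite (splitr d) ltrD// (lt_trans x'y).
  have gx' : `|g x - g x'| < e / 2.
    by apply: xd; apply: le_ball xx'; rewrite ler_pdivrMr// ler_peMr ?ler1n// ltW.
  rewrite -(subrKA (g x)) (le_lt_trans (ler_normD _ _))//.
  by rewrite (splitr e) ltrD// distrC.
move=> /(filterI (nbhs_right_gt 0))/filter_ex[r [r0 rQ]].
by exists r => // x y xab; exact: rQ.
Qed.

(** The increment of [f] telescopes over the cells. On each cell the mean value theorem replaces it
    by the mesh times a value of [g], which uniform continuity compares with the value at the left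
    node. *)
Lemma left_riemann_sum_cvg (R : realType) (f g : R -> R) (t : R) :
  0 < t -> continuous f -> continuous g ->
  (forall s : R, 0 < s -> is_derive s 1 f (g s)) ->
  (fun n => t / n.+1%:R * \sum_(k < n.+1) g (k%:R * (t / n.+1%:R))) @ \oo
    --> f t - f 0.
Proof.
move=> t0 cf cg fg; apply/cvgrPdist_le => e e0.
have et0 : 0 < e / t by rewrite divr_gt0.
have [r r0 gr] := uniform_continuity_segment 0 t cg et0.
(* Beyond [t / r] cells the mesh is smaller than [r]. *)
have [N tN] : exists N : nat, t / r < N%:R.
  by exists (Num.trunc (t / r)).+1; exact: truncnS_gt.
exists N => // n /= Nn; set h := t / n.+1%:R.
have n0 : (0 : R) < n.+1%:R by [].
have h0 : 0 < h by rewrite divr_gt0.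
have hr : h < r.
  rewrite ltr_pdivrMr// mulrC -ltr_pdivrMr// (lt_trans tN)// ltr_nat.
  by rewrite ltnS.
have hn : n.+1%:R * h = t by rewrite mulrC divfK// gt_eqF.
have -> : f t - f 0 = \sum_(k < n.+1) (f (k.+1%:R * h) - f (k%:R * h)).
  rewrite -(big_mkord xpredT (fun k => f (k.+1%:R * h) - f (k%:R * h))).
  by rewrite telescope_sumr// hn mul0r.
rewrite mulr_sumr -sumrB (le_trans (ler_norm_sum _ _ _))//.
(* The error [e] is shared equally among the cells, [h * (e / t)] for each. *)
have -> : e = \sum_(k < n.+1) h * (e / t).
  rewrite big_const_ord iter_addr_0 -mulr_natl mulrA hn mulrC divfK//.
  by rewrite gt_eqF.
apply: ler_sum => k _.
have kh0 : 0 <= k%:R * h by rewrite mulr_ge0// ltW.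
have khS : k%:R * h < k.+1%:R * h by rewrite ltr_pM2r// ltr_nat.
have [x xk ->] : exists2 x, x \in `]k%:R * h, k.+1%:R * h[ &
    f (k.+1%:R * h) - f (k%:R * h) = g x * (k.+1%:R * h - k%:R * h).
  apply: MVT => //; last exact: continuous_subspaceT.
  by move=> x; rewrite in_itv/= => /andP[kx _]; apply: fg; exact: le_lt_trans kx.
rewrite -mulrBl -natrB// subSnn mul1r mulrC -mulrBr normrM gtr0_norm//.
move: xk; rewrite in_itv/= => /andP[kx xk].
rewrite ler_pM2l// distrC ltW// gr//.
  rewrite in_itv/= kh0/= -hn ler_pM2r// ler_nat ltnW//.
rewrite distrC ger0_norm; last by rewrite subr_ge0 ltW.
rewrite ltrBlDr (lt_trans xk)// -addn1 natrD mulrDl mul1r addrC ltrD2r//.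
Qed.

Section path_chain_rule.
Context (R : realType) (d : nat).
Notation vec := 'rV[R]_d.

(** Freezing a path at its initial value for negative times makes it continuous on the whole line,
    as the calculus lemmas above and below require. *)
Lemma continuous_clamp (T : topologicalType) (X : R -> T) :
  {within `[0%R, +oo[, continuous X} -> continuous (fun s : R => X (Num.max 0 s)).
Proof.
move=> cX s.
have /subspace_continuousP cX' := cX.
have m0 : `[0%R, +oo[%classic (Num.max 0 s).
  by rewrite /= in_itv/= andbT le_max lexx.
have cmax : {for s, continuous (fun u : R => Num.max 0 u)}.
  by apply: (@continuous_max R R (cst 0) id); [exact: cvg_cst|exact: cvg_id].
move=> A nA; have {}nA := cX' _ m0 A nA.
apply: (@filterS _ (nbhs s) _ _ _ _ (cmax _ nA)) => u /=; apply.
by rewrite /= in_itv/= andbT le_max lexx.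
Qed.

(** By the fundamental theorem of calculus the integral equation says that [X] has derivative [V];
    the rest is the chain rule. *)
Lemma chain_rule_primitive (phi : vec -> R) (X V : R -> vec) (x : vec) (s : R) :
  (forall p, differentiable phi p) -> continuous V ->
  (forall r i, X r ord0 i =
     x ord0 i + \int[lebesgue_measure]_(u in `[0, r]) V u ord0 i) ->
  0 < s ->
  is_derive s 1 (phi \o X) (\sum_i partial i phi (X s) * V s ord0 i).
Proof.
move=> dphi cV XE s0.
have dX i : is_derive s 1 (fun r => X r ord0 i) (V s ord0 i).
  have cVi : continuous (fun r => V r ord0 i).
    by move=> r; apply: (@continuous_comp _ _ _ V (fun v : vec => v ord0 i));
      [exact: cV|exact: coord_continuous].
  under eq_fun do rewrite XE.
  (* The right end [s + 1] makes [s] an interior point, hence the derivative two-sided. *)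
  have [] := @continuous_FTC1_closed R (fun u => V u ord0 i) 0 s (s + 1).
  - by rewrite ltrDl.
  - apply: continuous_compact_integrable; first exact: segment_compact.
    exact: continuous_subspaceT.
  - exact: s0.
  - exact: cVi.
  move=> dF F's; have {F's}dF := DeriveDef dF (etrans (esym (derive1E _ _)) F's).
  rewrite -[X in is_derive _ _ _ X]add0r.
  exact: (is_deriveD (is_derive_cst (x ord0 i) s (1 : R)) dF).
have dX1 : derivable X s 1.
  by apply/derivable_mxP => i j; rewrite ord1; case: (dX j).
have diffX : differentiable X s by exact/derivable1_diffP.
have Vs : 'D_1 X s = V s.
  apply/rowP => i; rewrite derive_mx// mxE; apply: derive_val.
apply: DeriveDef.
  by apply/derivable1_diffP; exact: differentiable_comp.
rewrite deriveE; last exact: differentiable_comp.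
rewrite diff_comp//= -(deriveE (1 : R) diffX) Vs.
(* Expanding the velocity in the standard basis turns the differential into partial derivatives. *)
rewrite {1}(row_sum_delta (V s)) linear_sum; apply: eq_bigr => i _.
by rewrite linearZ /= /partial deriveE// mulrC.
Qed.

End path_chain_rule.

(** The clamped paths satisfy the previous lemmas and agree with [X] and [V] at every node, all
    nodes being nonnegative. *)
Lemma path_increment_cvg (R : realType) d (phi : 'rV[R]_d -> R)
    (X V : R -> 'rV[R]_d) (x : 'rV[R]_d) (t : R) :
  Ck 1 phi ->
  {within `[0%R, +oo[, continuous X} -> {within `[0%R, +oo[, continuous V} ->
  (forall r i, 0 <= r -> X r ord0 i =
     x ord0 i + \int[lebesgue_measure]_(u in `[0, r]) V u ord0 i) ->
  0 < t ->
  (fun n => t / n.+1%:R * \sum_(k < n.+1) (let s := k%:R * (t / n.+1%:R) in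
     \sum_i partial i phi (X s) * V s ord0 i)) @ \oo
    --> phi (X t) - phi x.
Proof.
move=> [dphi cphi] /continuous_clamp cX /continuous_clamp cV XE t0.
set Xc := (fun s : R => X (Num.max 0 s)) in cX.
set Vc := (fun s : R => V (Num.max 0 s)) in cV.
have X0 : X 0 = x.
  apply/rowP => i; rewrite XE// set_itv1 Rintegral_set1 addr0//.
(* For negative [r] the interval is empty and the clamped path sits at [X 0 = x], so the equation
   extends to all times. *)
have XcE r i : Xc r ord0 i =
    x ord0 i + \int[lebesgue_measure]_(u in `[0, r]) Vc u ord0 i.
  have [r0|r0] := leP 0 r.
    rewrite /Xc max_r// XE//; congr (_ + _); apply: eq_Rintegral => u.
    by rewrite inE/= in_itv/= => /andP[u0 _]; rewrite /Vc max_r.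
  by rewrite /Xc max_l ?ltW// X0 set_itv_ge ?Rintegral_set0 ?addr0// -ltNge.
pose g s := \sum_i partial i phi (Xc s) * Vc s ord0 i.
have cphi0 : continuous phi.
  by move=> p; exact: differentiable_continuous.
have cg : continuous g.
  move=> s; rewrite /g; apply: cvg_big => [|i _]; first exact: add_continuous.
  apply: cvgM.
    by apply: continuous_comp; [exact: cX|exact: cphi].
  by apply: (@continuous_comp _ _ _ Vc (fun v : 'rV[R]_d => v ord0 i));
    [exact: cV|exact: coord_continuous].
have cf : continuous (phi \o Xc).
  by move=> s; apply: continuous_comp; [exact: cX|exact: cphi0].
have := left_riemann_sum_cvg t0 cf cg (fun s => chain_rule_primitive dphi cV XcE).
rewrite /= /Xc max_r ?(ltW t0)// maxxx X0.
apply: cvg_trans; apply: near_eq_cvg; apply: nearW => n /=.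
congr (_ * _); apply: eq_bigr => k _; rewrite /g /Xc /Vc max_r//.
by rewrite mulr_ge0// divr_ge0// ltW.
Qed.

(** * Square-integrable functions and Jensen's inequality *)

Lemma Lnorm2E d (T : measurableType d) (R : realType)
    (m : {measure set T -> \bar R}) (f : T -> R) :
  ('N[m]_2%:E[EFin \o f] = (\int[m]_x (f x ^+ 2)%:E) `^ 2^-1)%E.
Proof.
rewrite unlock; congr (_ `^ _)%E; apply: eq_integral => x _.
by rewrite /= ?poweR_EFin powR_mulrn// real_normK// num_real.
Qed.

Lemma Lfun2P d (T : measurableType d) (R : realType)
    (m : {measure set T -> \bar R}) (f : T -> R) :
  f \in Lfun m 2%:E <->
  measurable_fun setT f /\ (\int[m]_x (f x ^+ 2)%:E < +oo)%E.
Proof.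
split => [mf|[mf foo]].
  split; first by move: mf; rewrite inE => /andP[/[!inE]].
  have /integrableP[_] := Lfun2_integrable_sqr mf.
  by under eq_integral do rewrite gee0_abs ?lee_fin ?sqr_ge0//.
rewrite inE; apply/andP; split; rewrite inE//= /finite_norm Lnorm2E.
exact: poweR_lty.
Qed.

(** Jensen's inequality for the square, obtained from Hölder against the constant 1. Unit mass is a
    hypothesis on a plain measure, so that kernel values [P t y] fit. *)
Lemma sqr_Rintegral_sub_le d (T : measurableType d) (R : realType)
    (m : {measure set T -> \bar R}) (f : T -> R) (c : R) :
  m setT = 1%E -> measurable_fun setT f ->
  (((\int[m]_y f y - c) ^+ 2)%:E <= \int[m]_y ((f y - c) ^+ 2)%:E)%E.
Proof.
move=> mT mf; pose g y := f y - c.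
have mg : measurable_fun setT g by exact: measurable_funB.
(* The infinite case absorbs every non-integrable [f], for which the real integral is only a default
   value. *)
have [->|foo] := eqVneq (\int[m]_y ((f y - c) ^+ 2)%:E)%E +oo%E.
  by rewrite leey.
have g2 : g \in Lfun m 2%:E by apply/Lfun2P; split => //; rewrite ltey.
have g1 : m.-integrable setT (EFin \o g).
  by apply/Lfun1_integrable; by apply: Lfun_subset12 => //; rewrite mT.
have c1 : m.-integrable setT (EFin \o cst c).
  apply/integrableP; split; first exact/measurable_EFinP/measurable_cst.
  by rewrite (eq_integral (cst `|c|%:E))// integral_cst//= mT mule1 ltry.
have -> : \int[m]_y f y - c = \int[m]_y g y.
  rewrite (_ : f = g \+ cst c); last by apply/funext => y; rewrite /= /g subrK.
  rewrite RintegralD// Rintegral_cst//= mT mulr1 addrK.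
  by [].
have : (`|\int[m]_y g y|%:E <= 'N[m]_2%:E[EFin \o g])%E.
  apply: (@le_trans _ _ ('N[m]_1[EFin \o g])%E).
    rewrite Lnorm1 -abse_EFin fineK; last exact: integrable_fin_num.
    by apply: le_abse_integral => //; exact/measurable_EFinP.
  have := @hoelder _ _ _ m g (cst 1) 2 2 mg (measurable_cst _) _ _ _.
  have -> : ('N[m]_2%:E[EFin \o cst 1%R] = 1)%E.
    rewrite Lnorm2E; under eq_integral do rewrite expr1n.
    by rewrite integral_cst//= mT mule1 poweR_EFin powR1.
  rewrite mule1.
  have -> : (g \* cst 1)%R = g by apply/funext => y /=; rewrite mulr1.
  by apply => //; lra.
rewrite Lnorm2E -/g; have [i i0 ->] : exists2 i, 0 <= i &
    (\int[m]_y (g y ^+ 2)%:E)%E = i%:E.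
  exists (fine (\int[m]_y (g y ^+ 2)%:E)%E).
    by apply: fine_ge0; apply: integral_ge0 => y _; rewrite lee_fin sqr_ge0.
  rewrite fineK// ge0_fin_numE ?ltey//.
  by apply: integral_ge0 => y _; rewrite lee_fin sqr_ge0.
rewrite poweR_EFin !lee_fin powR12_sqrt// => ai.
by rewrite -(sqr_sqrtr i0) -real_normK ?num_real// ler_sqr ?nnegrE ?sqrtr_ge0.
Qed.

(** * The semigroup increment *)

(** This is the nonnegativity of the empirical variance, with mean [S / N]. *)
Lemma sqr_sum_le (R : realFieldType) n (a : 'I_n.+1 -> R) :
  (\sum_i a i) ^+ 2 <= n.+1%:R * \sum_i a i ^+ 2.
Proof.
set S := \sum_i a i; set N : R := n.+1%:R.
have N0 : 0 < N by [].
have : 0 <= \sum_i (a i - S / N) ^+ 2 by apply: sumr_ge0 => i _; exact: sqr_ge0.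
have -> : \sum_i (a i - S / N) ^+ 2 = \sum_i a i ^+ 2 - S ^+ 2 / N.
  under eq_bigr => i _.
    rewrite (_ : _ ^+ 2 = a i ^+ 2 + (- (2 * (S / N)) * a i + (S / N) ^+ 2)).
      over.
    by ring.
  rewrite !big_split /= -mulr_sumr -/S sumr_const card_ord -mulr_natl -/N.
  by field; rewrite gt_eqF.
by rewrite subr_ge0 ler_pdivrMr// mulrC.
Qed.

Section one_point_increment.
Context (R : realType) (d : nat) (U : 'rV[R]_d -> R) (lambda gamma : R).
Variable P : R -> R.-pker (phase_space R d) ~> (phase_space R d).
Hypothesis P_gle : gle_transition_semigroup U lambda gamma P.
Variable phi : 'rV[R]_d -> R.
Hypothesis phi_C1 : Ck 1 phi.

(* The generator applied to [fun y => phi y.1.1]. *)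
Definition drift (y : phase_space R d) := \sum_i partial i phi y.1.1 * y.1.2 ord0 i.

Lemma measurable_Ck1 : measurable_fun setT phi.
Proof.
apply: continuous_measurable_rV => p; apply: differentiable_continuous.
by case: phi_C1.
Qed.

Lemma measurable_partial i : measurable_fun setT (partial i phi).
Proof. by apply: continuous_measurable_rV; case: phi_C1. Qed.

Lemma measurable_drift : measurable_fun setT drift.
Proof.
apply: measurable_lincomb => i.
  apply: measurableT_comp (measurable_partial i) _.
  exact: measurableT_comp measurable_fst measurable_fst.
apply: measurableT_comp (measurable_rV_coord i) _.
exact: measurableT_comp measurable_snd measurable_fst.
Qed.

(** The bound involves the solution only through its laws at the fixed times [k%:R * (t / n.+1%:R)],
    so that the starting point can be integrated out afterwards. *)
Lemma semigroup_increment_sqr_le (t : R) y0 : 0 < t ->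
  (((semigroup_op P t (fun y => phi y.1.1) y0 - phi y0.1.1) ^+ 2)%:E <=
  limn_einf (fun n => (t ^+ 2 / n.+1%:R)%:E *
    \sum_(k < n.+1) \int[P (k%:R * (t / n.+1%:R))%R y0]_y (drift y ^+ 2)%:E))%E.
Proof.
move=> t0.
have [_ /(_ y0) weak] := P_gle.
have [dO [Om [Pr [F [W [X [V [Z [fil bro sol]]]]]]]]] := weak.
move=> /(_ y0 _ _ _ _ _ _ _ _ fil bro sol) law.
have [[aX aV aZ] [cX cV _] eqs] := sol.
pose Y s w := (X s w, V s w, Z s w).
have adapted_measurable s (H : R -> Om -> 'rV[R]_d) : 0 <= s ->
    adapted F H -> measurable_fun setT (H s).
  move=> s0 aH _ A mA; rewrite setTI.
  by apply: (filtration_measurable fil s0); exact: aH.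
have mY s : 0 <= s -> measurable_fun setT (Y s).
  by move=> s0; apply: measurable_fun_pair; [apply: measurable_fun_pair|];
    exact: adapted_measurable.
(* Expectations along the chosen weak solution are kernel integrals, by uniqueness in law. *)
have EY s (h : phase_space R d -> \bar R) : 0 <= s ->
    measurable_fun setT h -> (forall y, 0 <= h y)%E ->
    (\int[Pr]_w h (Y s w) = \int[P s y0]_y h y)%E.
  move=> s0 mh h0.
  rewrite -(ge0_integral_pushforward (mY _ s0) Pr measurableT mh)//.
  by apply: eq_measure_integral => [|? A mA _]; [exact: mY|exact: law].
have mphi : measurable_fun setT (fun y : phase_space R d => phi y.1.1).
  apply: measurableT_comp measurable_Ck1 _.
  exact: measurableT_comp measurable_fst measurable_fst.
have J := @sqr_Rintegral_sub_le _ _ _ (P t y0) _ (phi y0.1.1) (prob_kernel y0) mphi.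
apply: (le_trans J).
have t0' := ltW t0.
rewrite -(EY t (fun y => ((phi y.1.1 - phi y0.1.1) ^+ 2)%:E))//; last 2 first.
- by apply/measurable_EFinP/measurable_funX/measurable_funB.
- by move=> y; rewrite lee_fin sqr_ge0.
have h0 n k : 0 <= k%:R * (t / n.+1%:R) by rewrite mulr_ge0// divr_ge0.
pose S n w := t / n.+1%:R * \sum_(k < n.+1) drift (Y (k%:R * (t / n.+1%:R)) w).
have mS n : measurable_fun setT (S n).
  apply: measurable_funM => //; apply: measurable_sum => k.
  by apply: measurableT_comp; [exact: measurable_drift|exact: mY].
(* The squared increment along the path is the almost sure limit of the squared Riemann sums [S n],
   so Fatou applies on [Om]. *)
apply: (@le_trans _ _ (limn_einf (fun n => \int[Pr]_w (S n w ^+ 2)%:E)))%E.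
  apply: fatou_ae_le.
  - by move=> n; exact/measurable_EFinP/measurable_funX.
  - by move=> n w; rewrite lee_fin sqr_ge0.
  - apply/measurable_EFinP/measurable_funX/measurable_funB => //.
    by apply: measurableT_comp measurable_Ck1 _; exact: adapted_measurable.
  apply: filterS eqs => w eqw.
  apply: cvg_EFin; first exact: nearW.
  have XE r i : 0 <= r -> X r w ord0 i = y0.1.1 ord0 i +
      \int[lebesgue_measure]_(u in `[0, r]) V u w ord0 i.
    by move=> r0; have [] := eqw r i r0.
  have := path_increment_cvg phi_C1 (cX w) (cV w) XE t0.
  move=> c; under eq_fun do rewrite /= expr2.
  by rewrite expr2; apply: cvgM; exact: c.
apply: le_limn_einf => n.
have mD k : measurable_fun setT (fun w => drift (Y (k%:R * (t / n.+1%:R)) w) ^+ 2).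
  apply: measurable_funX; apply: measurableT_comp measurable_drift _.
  exact: mY.
have -> : ((t ^+ 2 / n.+1%:R)%:E *
    \sum_(k < n.+1) \int[P (k%:R * (t / n.+1%:R))%R y0]_y (drift y ^+ 2)%:E =
  \int[Pr]_w ((t ^+ 2 / n.+1%:R) *
    \sum_(k < n.+1) (drift (Y (k%:R * (t / n.+1%:R)) w)) ^+ 2)%:E)%E.
  under [RHS]eq_integral do rewrite EFinM -sumEFin.
  rewrite ge0_integralZl//; last 3 first.
  - by apply: emeasurable_sum => k; exact/measurable_EFinP.
  - by move=> w _; apply: sume_ge0 => k _; rewrite lee_fin sqr_ge0.
  - by rewrite lee_fin divr_ge0// sqr_ge0.
  rewrite ge0_integral_sum//; last 2 first.
  - by move=> k; exact/measurable_EFinP.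
  - by move=> k w _; rewrite lee_fin sqr_ge0.
  congr (_ * _)%E; apply: eq_bigr => k _.
  rewrite -(EY _ (fun y => (drift y ^+ 2)%:E))//.
  - by apply/measurable_EFinP/measurable_funX; exact: measurable_drift.
  - by move=> y; rewrite lee_fin sqr_ge0.
apply: ge0_le_integral => //.
- by move=> w _; rewrite lee_fin sqr_ge0.
- by apply/measurable_EFinP/measurable_funX.
- apply/measurable_EFinP/measurable_funM => //.
  exact: measurable_sum.
(* The squared mesh [(t / n.+1%:R) ^+ 2] times the number [n.+1] of terms is the factor
   [t ^+ 2 / n.+1%:R]. *)
move=> w _; rewrite lee_fin /S exprMn expr_div_n.
apply: le_trans (ler_wpM2l _ (sqr_sum_le _)) _.
  by rewrite divr_ge0// sqr_ge0.
rewrite mulrA le_eqVlt; apply/orP; left; apply/eqP; congr (_ * _).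
by field.
Qed.
End one_point_increment.

Lemma ge0_lty_real (R : realType) (x : \bar R) :
  (0 <= x)%E -> (x < +oo)%E -> exists2 a, 0 <= a & x = a%:E.
Proof.
move=> x0 xoo; exists (fine x); first exact: fine_ge0.
by rewrite fineK// ge0_fin_numE.
Qed.

Lemma measurable_semigroup_op (R : realType) d (T : measurableType d)
    (P : R -> R.-pker T ~> T) (t : R) (f : T -> R) :
  measurable_fun setT f -> measurable_fun setT (semigroup_op P t f).
Proof.
move=> mf; have mEf : measurable_fun setT (EFin \o f) by exact/measurable_EFinP.
apply: (measurableT_comp (fine_measurable _)) => //=.
under eq_fun do rewrite integralE.
have mk A : measurable A -> measurable_fun setT (P t ^~ A).
  by move=> mA; exact: measurable_kernel.
apply: emeasurable_funB; apply: measurable_fun_integral_kernel => //.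
- exact: measurable_funepos.
- exact: measurable_funeneg.
Qed.

Lemma semigroup_op0 (R : realType) d (T : measurableType d)
    (P : R -> R.-pker T ~> T) (f : T -> R) y :
  markov_semigroup P -> measurable_fun setT f -> semigroup_op P 0 f y = f y.
Proof.
move=> [P0 _] mf; rewrite /semigroup_op /Rintegral.
rewrite (@eq_measure_integral _ _ _ _ \d_y); last by move=> A mA _; exact: P0.
rewrite integral_dirac//; last exact/measurable_EFinP.
by rewrite diracT mul1e.
Qed.

Section L2_increment.
Context (R : realType) (d : nat) (U : 'rV[R]_d -> R) (lambda gamma : R).
Variable mu : probability 'rV[R]_d R.
Variable P : R -> R.-pker (phase_space R d) ~> (phase_space R d).
Hypothesis P_gle : gle_transition_semigroup U lambda gamma P.
Hypothesis P_invariant : invariant_measure (mu_hat mu) P.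
Variable phi : 'rV[R]_d -> R.
Hypothesis phi_C1 : Ck 1 phi.

Let Phi (y : phase_space R d) := phi y.1.1.

Let measurable_Phi : measurable_fun setT Phi.
Proof.
apply: measurableT_comp (measurable_Ck1 phi_C1) _.
exact: measurableT_comp measurable_fst measurable_fst.
Qed.

Let energy := (\int[mu]_x (\sum_i partial i phi x ^+ 2)%:E)%E.

(** The pointwise bounds are integrated over the starting point. Invariance makes the integral of
    the [n]-th bound independent of [n], so the lower limit is that of a constant sequence. *)
Lemma semigroup_increment_L2_le (t : R) : 0 <= t ->
  (\int[mu_hat mu]_y ((semigroup_op P t Phi y - Phi y) ^+ 2)%:E
     <= (t ^+ 2)%:E * energy)%E.
Proof.
(* The Riemann sums require [0 < t]; at time 0 the kernel is a point mass and the increment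
   vanishes. *)
rewrite le_eqVlt => /predU1P[<-|t0].
  under eq_integral => y _.
    rewrite semigroup_op0//; last by case: P_gle.
    rewrite subrr expr0n /=.
    over.
  by rewrite integral0 expr0n mul0e.
have drift0 y : (0 <= (drift phi y ^+ 2)%:E)%E by rewrite lee_fin sqr_ge0.
have mdrift : measurable_fun setT (fun y => (drift phi y ^+ 2)%:E).
  by apply/measurable_EFinP/measurable_funX; exact: measurable_drift.
have h0 n k : 0 <= k%:R * (t / n.+1%:R) by rewrite mulr_ge0// divr_ge0// ltW.
pose B n y := ((t ^+ 2 / n.+1%:R)%:E *
    \sum_(k < n.+1) \int[P (k%:R * (t / n.+1%:R))%R y]_y' (drift phi y' ^+ 2)%:E)%E.
have mI s : measurable_fun setT (fun y => \int[P s y]_y' (drift phi y' ^+ 2)%:E)%E.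
  apply: measurable_fun_integral_kernel => // A mA; exact: measurable_kernel.
have c0 n : (0 <= (t ^+ 2 / n.+1%:R)%:E)%E by rewrite lee_fin divr_ge0// sqr_ge0.
have mS n : measurable_fun setT (fun y =>
    \sum_(k < n.+1) \int[P (k%:R * (t / n.+1%:R))%R y]_y' (drift phi y' ^+ 2)%:E)%E.
  exact: emeasurable_sum.
have mB n : measurable_fun setT (B n) by exact: measurable_funeM.
have I0 s y : (0 <= \int[P s y]_y' (drift phi y' ^+ 2)%:E)%E by exact: integral_ge0.
have B0 n y : (0 <= B n y)%E by rewrite mule_ge0// sume_ge0.
have IB n : (\int[mu_hat mu]_y B n y =
    (t ^+ 2)%:E * \int[mu_hat mu]_y (drift phi y ^+ 2)%:E)%E.
  rewrite ge0_integralZl//; last by move=> y _; exact: sume_ge0.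
  rewrite ge0_integral_sum//.
  set J := (\int[mu_hat mu]_y (drift phi y ^+ 2)%:E)%E.
  (* Each term equals [J] by invariance; the factor 1 lets the sum collapse to [n.+1] times [J],
     cancelling the denominator. *)
  rewrite (eq_bigr (fun=> 1%:E * J)%E); last first.
    move=> k _; rewrite mul1e (ge0_integral_mixture (nu := mu_hat mu))// => A mA.
      exact: measurable_kernel.
    exact: P_invariant.
  rewrite -ge0_sume_distrl// sumEFin sumr_const card_ord muleA -EFinM.
  by rewrite divfK.
apply: (@le_trans _ _ (\int[mu_hat mu]_y limn_einf (B ^~ y)))%E.
  apply: ge0_le_integral => //.
  - by move=> y _; rewrite lee_fin sqr_ge0.
  - apply/measurable_EFinP/measurable_funX/measurable_funB => //.
    exact: measurable_semigroup_op.
  - exact: measurable_fun_limn_einf.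
  - by move=> y _; exact: semigroup_increment_sqr_le P_gle _ phi_C1 _ _ t0.
apply: le_trans (fatou _ measurableT _ _) _ => //.
under eq_fun do rewrite IB.
rewrite is_cvg_limn_einfE; last exact: is_cvg_cst.
rewrite lim_cst// lee_wpmul2l ?lee_fin ?sqr_ge0//.
apply: (mu_hat_velocity_second_moment_le mu (g := fun i => partial i phi)).
exact: measurable_partial.
Qed.

(** Minkowski applied to [Phi] as its increment plus its image bounds [1 - expR (-1)] times the norm
    of [phi] by [t] times the norm of the gradient. The factor is at least 1/2, and squaring gives
    1/4. *)
Lemma relaxed_dirichlet_ineq (t : R) : 0 <= t ->
  (forall f, L20 (mu_hat mu) f -> ('N[mu_hat mu]_2%:E [EFin \o semigroup_op P t f]
     <= (expR (-1))%:E * 'N[mu_hat mu]_2%:E [EFin \o f])%E) ->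
  phi \in Lfun mu 2%:E -> \int[mu]_x phi x = 0 -> (energy < +oo)%E ->
  ((4^-1)%:E * (\int[mu]_x (phi x ^+ 2)%:E) <= (t ^+ 2)%:E * energy)%E.
Proof.
move=> t0 relax /Lfun2P[mphi phi2] phi_mean0 energy_fin.
have mphi2 : measurable_fun setT (fun x => (phi x ^+ 2)%:E).
  by apply/measurable_EFinP/measurable_funX.
have sq0 (x : R) : (0 <= (x ^+ 2)%:E)%E by rewrite lee_fin sqr_ge0.
have energy0 : (0 <= energy)%E.
  by apply: integral_ge0 => x _; rewrite lee_fin sumr_ge0// => i _; exact: sqr_ge0.
have Phi2 : (\int[mu_hat mu]_y (Phi y ^+ 2)%:E = \int[mu]_x (phi x ^+ 2)%:E)%E.
  by rewrite (ge0_integral_mu_hat_position mu mphi2).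
have LPhi : L20 (mu_hat mu) Phi.
  split; first by apply/Lfun2P; rewrite Phi2.
  by rewrite (Rintegral_mu_hat_position mu mphi).
have mP := measurable_semigroup_op P t measurable_Phi.
have := minkowski_EFin (mu_hat mu) (measurable_funB measurable_Phi mP) mP (ler1n _ 2).
have -> : ((Phi \- semigroup_op P t Phi) \+ semigroup_op P t Phi)%R = Phi.
  by apply/funext => y /=; rewrite subrK.
move=> /le_trans/(_ (leeD2l _ (relax _ LPhi))).
have incr : ('N[mu_hat mu]_2%:E[EFin \o (Phi \- semigroup_op P t Phi)%R] <=
    ((t ^+ 2)%:E * energy) `^ 2^-1)%E.
  have sqrB (y : phase_space R d) : ((Phi \- semigroup_op P t Phi) y) ^+ 2 =
      (semigroup_op P t Phi y - Phi y) ^+ 2 by rewrite -sqrrN opprB.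
  rewrite Lnorm2E; under eq_integral do rewrite sqrB.
  apply: gt0_ler_poweR => //; last exact: semigroup_increment_L2_le.
    by rewrite in_itv/= leey andbT; apply: integral_ge0.
  by rewrite in_itv/= leey andbT mule_ge0.
move=> /le_trans/(_ (leeD2r _ incr)).
rewrite Lnorm2E Phi2.
have [a a0 ->] := ge0_lty_real (integral_ge0 _ (fun x _ => sq0 (phi x))) phi2.
have [b b0 ->] := ge0_lty_real energy0 energy_fin.
rewrite -!EFinM !poweR_EFin -?EFinM -EFinD !lee_fin.
rewrite !powR12_sqrt ?mulr_ge0 ?sqr_ge0// => le_a.
(* From [1 + x <= expR x] at [x = 1]. *)
have expN1 : expR (-1) <= 2^-1 :> R.
  by rewrite expRN lef_pV2 ?posrE ?expR_gt0//; exact: expR_ge1Dx.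
have le_a2 : Num.sqrt a / 2 <= Num.sqrt (t ^+ 2 * b).
  have := ler_wpM2r (sqrtr_ge0 a) expN1; lra.
rewrite -[leRHS]sqr_sqrtr ?mulr_ge0 ?sqr_ge0//.
rewrite (_ : 4^-1 * a = (Num.sqrt a / 2) ^+ 2).
  by rewrite ler_sqr ?nnegrE ?divr_ge0 ?sqrtr_ge0.
by rewrite expr_div_n sqr_sqrtr// mulrC; congr (_ / _); ring.
Qed.

End L2_increment.

(** * Density in the Sobolev space *)

Section Lfun2_norm.
Context d (T : measurableType d) (R : realType) (mu : probability T R).
Implicit Types f g : T -> R.
Notation norm2 f := ('N[mu]_2%:E[EFin \o f])%E.

Lemma fine_Lnorm2K f : f \in Lfun mu 2%:E -> (fine (norm2 f))%:E = norm2 f.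
Proof.
rewrite inE => /andP[_]; rewrite inE /= /finite_norm => foo.
by rewrite fineK// ge0_fin_numE// Lnorm_ge0.
Qed.

Lemma integral_sqr_Lfun2 f : f \in Lfun mu 2%:E ->
  (\int[mu]_x (f x ^+ 2)%:E = (fine (norm2 f) ^+ 2)%:E)%E.
Proof.
move=> /Lfun2P[mf f2]; rewrite Lnorm2E.
have f0 : (0 <= \int[mu]_x (f x ^+ 2)%:E)%E.
  by apply: integral_ge0 => x _; rewrite lee_fin sqr_ge0.
have [a a0 ->] := ge0_lty_real f0 f2.
by rewrite poweR_EFin /= powR12_sqrt// sqr_sqrtr.
Qed.

Lemma Lfun2B f g : f \in Lfun mu 2%:E -> g \in Lfun mu 2%:E ->
  (f \- g)%R \in Lfun mu 2%:E.
Proof.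
move=> f2 g2; have p1 : (1 <= 2%:E :> \bar R)%E by rewrite lee_fin ler1n.
exact: ((Lfun_addr_closed mu p1).2 f (- g) f2 (Lfun_oppr_closed g2)).
Qed.

Lemma Lnorm2_subC f g : norm2 (f \- g)%R = norm2 (g \- f)%R.
Proof.
by rewrite !Lnorm2E; under eq_integral do rewrite /= -sqrrN opprB.
Qed.

Lemma le_fine_Lnorm2_sub f g : f \in Lfun mu 2%:E -> g \in Lfun mu 2%:E ->
  fine (norm2 f) <= fine (norm2 g) + fine (norm2 (f \- g)%R).
Proof.
move=> f2 g2; have fg2 := Lfun2B f2 g2.
rewrite -lee_fin (EFinD (fine _)) !fine_Lnorm2K// addeC.
have [[mfg _] [mg _]] := conj ((Lfun2P _ _).1 fg2) ((Lfun2P _ _).1 g2).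
have := minkowski_EFin mu mfg mg (ler1n R 2).
have -> : ((f \- g) \+ g)%R = f by apply/funext => x /=; rewrite subrK.
by [].
Qed.

(** Reverse triangle inequality, used in both directions. *)
Lemma fine_Lnorm2_cvg (u : nat -> T -> R) f :
  (forall n, u n \in Lfun mu 2%:E) -> f \in Lfun mu 2%:E ->
  norm2 (u n \- f)%R @[n --> \oo] --> 0%E ->
  fine (norm2 (u n)) @[n --> \oo] --> fine (norm2 f).
Proof.
move=> u2 f2 /fine_cvgP[_ uf0]; apply/cvgrPdist_le => e e0.
have /cvgrPdist_le/(_ _ e0) := uf0.
apply: filterS => n /=; rewrite sub0r normrN => ufe.
have {}ufe := le_trans (ler_norm _) ufe.
have := le_fine_Lnorm2_sub (u2 n) f2.
have := le_fine_Lnorm2_sub f2 (u2 n); rewrite Lnorm2_subC => h1 h2.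
by rewrite ler_norml; apply/andP; split; lra.
Qed.

(* Subtracting the means does not destroy convergence to a centered limit:
   [|int u_n| = |int (u_n - f)| <= |u_n - f|_L2]. *)
Lemma centered_Lnorm2_cvg (u : nat -> T -> R) f :
  (forall n, u n \in Lfun mu 2%:E) -> f \in Lfun mu 2%:E ->
  \int[mu]_x f x = 0 ->
  norm2 (u n \- f)%R @[n --> \oo] --> 0%E ->
  norm2 ((u n \- cst (\int[mu]_x u n x)) \- f)%R @[n --> \oo] --> 0%E.
Proof.
move=> u2 f2 f0 uf0.
have L1 h : h \in Lfun mu 2%:E -> mu.-integrable setT (EFin \o h).
  move=> h2; apply/Lfun1_integrable; apply: Lfun_subset12 => //.
  exact: fin_num_measure.
have bound n : (norm2 ((u n \- cst (\int[mu]_x u n x)) \- f)%R <=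
    norm2 (u n \- f)%R + norm2 (u n \- f)%R)%E.
  have uf2 := Lfun2B (u2 n) f2; have [muf _] := (Lfun2P _ _).1 uf2.
  pose c := \int[mu]_x u n x.
  have -> : ((u n \- cst c) \- f)%R = ((u n \- f) \+ cst (- c))%R.
    by apply/funext => x /=; rewrite /cst; ring.
  apply: le_trans (minkowski_EFin mu muf _ (ler1n R 2)) _ => //.
  rewrite leeD2l// [leLHS]Lnorm2E -(fine_Lnorm2K uf2).
  rewrite (eq_integral (cst ((- c) ^+ 2)%:E))// integral_cst//= probability_setT mule1.
  rewrite sqrrN poweR_EFin lee_fin powR12_sqrt ?sqr_ge0//.
  rewrite -ler_sqr ?nnegrE ?sqrtr_ge0 ?fine_ge0 ?Lnorm_ge0//.
  rewrite sqr_sqrtr ?sqr_ge0// -lee_fin -integral_sqr_Lfun2//.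
  (* The limit [f] is centered, so the mean of [u n] is that of the difference, which Jensen bounds
     by its norm. *)
  have -> : c = \int[mu]_x ((u n \- f)%R x).
    by rewrite RintegralB//; [rewrite f0 subr0|exact: L1..].
  have := sqr_Rintegral_sub_le 0 (probability_setT mu) muf.
  by rewrite subr0; under [leRHS]eq_integral do rewrite subr0.
apply: (@squeeze_cvge _ _ _ _ (cst 0%E) _
  (fun n => norm2 (u n \- f)%R + norm2 (u n \- f)%R)%E) => /=.
- by apply: nearW => n; rewrite Lnorm_ge0 bound.
- exact: cvg_cst.
- by rewrite -[X in _ --> X](adde0 0%E); apply: cvgeD.
Qed.

End Lfun2_norm.

Lemma partial_sub_cst (R : realType) d (phi : 'rV[R]_d -> R) c i :
  (forall x, differentiable phi x) ->
  partial i (phi \- cst c)%R = partial i phi.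
Proof.
move=> dphi; apply/funext => x; rewrite /partial.
rewrite (deriveB (diff_derivable (dphi x)) (derivable_cst c x _)).
by rewrite derive_cst subr0.
Qed.

Lemma Ck1_sub_cst (R : realType) d (phi : 'rV[R]_d -> R) c :
  Ck 1 phi -> Ck 1 (phi \- cst c)%R.
Proof.
move=> [dphi cphi]; split=> [x|i].
  exact: (differentiableB (dphi x) (differentiable_cst c x)).
by rewrite partial_sub_cst//; exact: cphi.
Qed.

Lemma integral_sum_sqr_Lfun2 d (T : measurableType d) (R : realType)
    (mu : probability T R) n (f : 'I_n -> T -> R) :
  (forall i, f i \in Lfun mu 2%:E) ->
  (\int[mu]_x (\sum_i f i x ^+ 2)%:E =
   (\sum_i fine ('N[mu]_2%:E[EFin \o f i]) ^+ 2)%:E)%E.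
Proof.
move=> f2; under eq_integral do rewrite -sumEFin.
rewrite ge0_integral_sum//; last 2 first.
- move=> i; have [mf _] := (Lfun2P _ _).1 (f2 i).
  by apply/measurable_EFinP; exact: measurable_funX.
- by move=> i x _; rewrite lee_fin sqr_ge0.
by rewrite -sumEFin; apply: eq_bigr => i _; exact: integral_sqr_Lfun2.
Qed.

(** Both sides are continuous in the Sobolev norm, so the inequality passes from smooth functions to
    their closure. *)
Lemma relaxed_H1_ineq (R : realType) (d : nat) (U : 'rV[R]_d -> R)
    (lambda gamma : R) (mu : probability 'rV[R]_d R)
    (P : R -> R.-pker (phase_space R d) ~> (phase_space R d)) (t : R) f g :
  gle_transition_semigroup U lambda gamma P ->
  invariant_measure (mu_hat mu) P -> 0 <= t ->
  (forall f, L20 (mu_hat mu) f -> ('N[mu_hat mu]_2%:E [EFin \o semigroup_op P t f]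
     <= (expR (-1))%:E * 'N[mu_hat mu]_2%:E [EFin \o f])%E) ->
  H1 mu f g -> \int[mu]_x f x = 0 ->
  4^-1 * \int[mu]_x (f x ^+ 2) <= t ^+ 2 * \int[mu]_x sqnorm (g x).
Proof.
move=> P_gle P_inv t0 relax [f2 g2 [phi [sphi phi2 dphi2 phif dphig]]] f0.
rewrite /Rintegral integral_sqr_Lfun2// integral_sum_sqr_Lfun2//=.
(* The relaxation bound is available for centered functions only; removing the mean leaves the
   partial derivatives unchanged. *)
pose psi n := (phi n \- cst (\int[mu]_x phi n x))%R.
have c2 c : cst c \in Lfun mu 2%:E by exact: Lfun_cst.
have psi2 n : psi n \in Lfun mu 2%:E by exact: Lfun2B.
have psi0 n : \int[mu]_x psi n x = 0.
  have L1 h : h \in Lfun mu 2%:E -> mu.-integrable setT (EFin \o h).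
    move=> h2; apply/Lfun1_integrable; apply: Lfun_subset12 => //.
    exact: fin_num_measure.
  rewrite RintegralB//; [|exact: L1..].
  by rewrite Rintegral_cst//= probability_setT mulr1 subrr.
have dphi n : forall x, differentiable (phi n) x by case: (sphi n 1).
have psif := fine_Lnorm2_cvg psi2 f2 (centered_Lnorm2_cvg phi2 f2 f0 phif).
have dpsig i := fine_Lnorm2_cvg (fun n => dphi2 n i) (g2 i) (dphig i).
have sqr_cvg (u : nat -> R) (l : R) : u @ \oo --> l -> u n ^+ 2 @[n --> \oo] --> l ^+ 2.
  by move=> ul; rewrite expr2; under eq_fun do rewrite expr2; exact: cvgM.
apply: (@ler_cvg_to _ \oo _ _
  (fun n => 4^-1 * fine ('N[mu]_2%:E[EFin \o psi n]) ^+ 2)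
  (fun n => t ^+ 2 * \sum_i fine ('N[mu]_2%:E[EFin \o partial i (phi n)]) ^+ 2)).
- exact: (cvgM (cvg_cst _) (sqr_cvg _ _ psif)).
- apply: (cvgM (cvg_cst _)); apply: cvg_big => [|i _]; first exact: add_continuous.
  exact: (sqr_cvg _ _ (dpsig i)).
apply: nearW => n.
have psi1 : Ck 1 (psi n) by apply: Ck1_sub_cst; exact: sphi.
have := relaxed_dirichlet_ineq P_gle P_inv psi1 t0 relax (psi2 n) (psi0 n).
have -> : (fun x => (\sum_i partial i (psi n) x ^+ 2)%:E) =
    (fun x => (\sum_i partial i (phi n) x ^+ 2)%:E).
  apply/funext => x; congr EFin; apply: eq_bigr => i _.
  by rewrite partial_sub_cst.
rewrite integral_sum_sqr_Lfun2// integral_sqr_Lfun2// -!EFinM lee_fin.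
by apply; rewrite ltry.
Qed.

(** * From the Dirichlet inequality to the relaxation time *)

Theorem corollary2 (R : realType) (d : nat) (U : 'rV[R]_d -> R)
    (lambda gamma : R) (mu : probability 'rV[R]_d R)
    (P : R -> R.-pker (phase_space R d) ~> (phase_space R d))
    (U_C1 : Ck 1 U) (lambda_gt0 : 0 < lambda) (gamma_gt0 : 0 < gamma)
    (mu_density : proportional_to_exp_opp mu U)
    (poincare : 0 < poincare_constant mu)
    (P_gle : gle_transition_semigroup U lambda gamma P)
    (P_invariant : invariant_measure (mu_hat mu) P) :
  ((2^-1 * poincare_constant mu `^ (- 2^-1))%:E
     <= relaxation_time (mu_hat mu) P)%E.
Proof.
apply: le_ereal_inf_tmp => _ [t [t0 relax] <-]; rewrite lee_fin.
(* The infimum of the empty set is 0, so a positive constant provides a quotient. *)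
have [r0 rq0] : rayleigh_quotients mu !=set0.
  apply/set0P; apply: contraTneq poincare => S0.
  by rewrite /poincare_constant S0 inf0 ltxx.
have le_ray r : rayleigh_quotients mu r -> 4^-1 <= t ^+ 2 * r.
  move=> [f [g [fg fN0 f0 ->]]].
  have le_fg := relaxed_H1_ineq P_gle P_invariant t0 relax fg f0.
  have f2 : f \in Lfun mu 2%:E by case: fg.
  (* A vanishing norm would make [f] zero almost everywhere; positivity allows division by it. *)
  have f2_gt0 : 0 < \int[mu]_x (f x ^+ 2).
    rewrite lt_neqAle; apply/andP; split; last first.
      by apply: Rintegral_ge0 => x _; exact: sqr_ge0.
    apply: contra_not_neq fN0 => If0.
    have [mf _] := (Lfun2P _ _).1 f2.
    have : ('N[mu]_2%:E[EFin \o f] = 0)%E.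
      move: If0; rewrite /Rintegral integral_sqr_Lfun2//= => /esym/eqP.
      by rewrite sqrf_eq0 => /eqP N0; rewrite -(fine_Lnorm2K f2) N0.
    have mEf : measurable_fun setT (EFin \o f) by exact/measurable_EFinP.
    have p0 : (0 < 2%:E :> \bar R)%E by rewrite lte_fin.
    move=> /(Lnorm_eq0_eq0 mEf p0).
    by apply: filterS => x /(_ I) [].
  by rewrite mulrA ler_pdivlMr.
(* At [t = 0] the bound on any quotient would read [4^-1 <= 0]. *)
have t_gt0 : 0 < t.
  rewrite lt_neqAle t0 andbT; apply: contraTneq (le_ray _ rq0) => <-.
  by rewrite expr0n mul0r -ltNge invr_gt0.
have pc_ge : (4 * t ^+ 2)^-1 <= poincare_constant mu.
  apply: lb_le_inf; first by exists r0.
  by move=> r /le_ray tr; rewrite invfM mulrC ler_pdivrMl// exprn_gt0.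
have pc0 := ltW poincare.
rewrite powRN powR12_sqrt//.
(* The goal becomes [(2 * t)^-1 <= Num.sqrt (poincare_constant mu)], whose square is [pc_ge]. *)
rewrite ler_pdivrMl// -[2 * t]invrK lef_pV2 ?posrE ?sqrtr_gt0 ?invr_gt0 ?mulr_gt0//.
rewrite -ler_sqr ?nnegrE ?sqrtr_ge0 ?invr_ge0 ?mulr_ge0//.
rewrite sqr_sqrtr// (le_trans _ pc_ge)// exprVn exprMn -natrX.
exact: lexx.
Qed.
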